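(* Let $((\mathfrak g,[\cdot,\cdot]_{\mathfrak g}),(V;\rho),T)$ be a Lie-Leibniz triple and $\mathfrak T:W\to\mathfrak h$ a linear map of vector spaces. Central extensions of $((\mathfrak g,[\cdot,\cdot]_{\mathfrak g}),(V;\rho),T)$ by $(\mathfrak h,W,\mathfrak T)$ are classified by the second cohomology group $\mathcal H^2_{\rm tri}(\mathfrak g,\rho,T,\mathfrak T)$: assigning to a central extension the cohomology class of the $2$-cocycle $(\omega,\varpi,\mathcal T)$ associated with any section gives a bijection between the set of isomorphism classes of central extensions and $\mathcal H^2_{\rm tri}(\mathfrak g,\rho,T,\mathfrak T)$.
   Context: A Lie-Leibniz triple $((\mathfrak g,[\cdot,\cdot]_{\mathfrak g}),(V;\rho),T)$ consists of a Lie algebra $\mathfrak g$ over a field, a representation $\rho:\mathfrak g\to\mathfrak{gl}(V)$, and a linear map $T:V\to\mathfrak g$ with $[Tu,Tv]_{\mathfrak g}=T(\rho(Tu)v)$. A homomorphism from $(\mathfrak g',V',T')$ to $(\mathfrak g,V,T)$ is a pair of a Lie algebra homomorphism $\phi:\mathfrak g'\to\mathfrak g$ and a linear map $\varphi:V'\to V$ with $T\varphi=\phi T'$ and $\varphi(\rho'(x)u)=\rho(\phi(x))\varphi(u)$; an isomorphism is one with both maps invertible. $(\mathfrak h,W,\mathfrak T)$ is regarded as a Lie-Leibniz triple with zero bracket and zero action. Extension of $(\mathfrak g,V,T)$ by $(\mathfrak h,W,\mathfrak T)$: a Lie-Leibniz triple $((\hat{\mathfrak g},[\cdot,\cdot]_{\hat{\mathfrak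 g}}),(\hat V,\hat\rho),\hat T)$ with homomorphisms of Lie-Leibniz triples $(\mathfrak i,i):(\mathfrak h,W,\mathfrak T)\to(\hat{\mathfrak g},\hat V,\hat T)$ and $(\mathfrak p,p):(\hat{\mathfrak g},\hat V,\hat T)\to(\mathfrak g,V,T)$ such that $0\to\mathfrak h\to\hat{\mathfrak g}\to\mathfrak g\to0$ and $0\to W\to\hat V\to V\to0$ are exact. It is central if $[\alpha,\hat x]_{\hat{\mathfrak g}}=0$, $\hat\rho(\hat x)\xi=0$, $\hat\rho(\alpha)\hat u=0$ for all $\alpha\in\mathfrak h,\xi\in W,\hat x\in\hat{\mathfrak g},\hat u\in\hat V$ (identifying $\mathfrak h,W$ with their images). Two central extensions $\tilde{}$ and $\hat{}$ are isomorphic if there is an isomorphism of Lie-Leibniz triples $(\kappa,\lambda)$, $\kappa:\tilde{\mathfrak g}\to\hat{\mathfrak g}$, $\lambda:\tilde V\to\hat V$, compatible with the inclusions of $\mathfrak h,W$ and the projections to $\mathfrak g,V$ (identity on $\mathfrak h,W,\mathfrak g,V$). A section consists of linear maps $\mathfrak s:\mathfrak g\to\hat{\mathfrak g}$, $s:V\to\hat V$ with $\mathfrak p\mathfrak s=\mathrm{Id}$, $ps=\mathrm{Id}$. Its associated cocycle $(\omega,\varpi,\mathcal T)\in\mathrm{Hom}(\wedge^2\mathfrak g,\mathfrak h)\oplus\mathrm{Hom}(\mathfrak g\otimes V,W)\oplus\mathrm{Hom}(V,\mathfrak h)$ is $\omega(x,y)=[\mathfrak s(x),\mathfrak s(y)]_{\hat{\mathfrak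 g}}-\mathfrak s[x,y]_{\mathfrak g}$, $\varpi(x,u)=\hat\rho(\mathfrak s(x))s(u)-s(\rho(x)u)$, $\mathcal T(u)=\hat T(s(u))-\mathfrak s(Tu)$; its class is independent of the section. $\mathcal H^\bullet_{\rm tri}(\mathfrak g,\rho,T,\mathfrak T)$ is the cohomology with trivial coefficients in $W\xrightarrow{\mathfrak T}\mathfrak h$: cochains $\mathfrak C^0=0$, $\mathfrak C^n=\mathrm{Hom}(\wedge^n\mathfrak g,\mathfrak h)\oplus\mathrm{Hom}(\wedge^{n-1}\mathfrak g\otimes V,W)\oplus\mathrm{Hom}(\otimes^{n-1}V,\mathfrak h)$ for $n\ge1$, and $\mathcal D_R(f,\theta)=(\delta f,\partial\theta+\Omega f)$ for $f=(f_{\mathfrak g},f_V)$, with $(\delta f)_{\mathfrak g}(x_1,\dots,x_{n+1})=\sum_{i<j}(-1)^{i}f_{\mathfrak g}(x_1,\dots,\hat x_i,\dots,x_{j-1},[x_i,x_j]_{\mathfrak g},x_{j+1},\dots,x_{n+1})$, $(\delta f)_V(x_1,\dots,x_n,v)=\sum_{i<j}(-1)^if_V(x_1,\dots,\hat x_i,\dots,x_{j-1},[x_i,x_j]_{\mathfrak g},x_{j+1},\dots,x_n,v)-\sum_{i=1}^n(-1)^{i+1}f_V(x_1,\dots,\hat x_i,\dots,x_n,\rho(x_i)v)$, $\partial\theta(u_1,\dots,u_n)=\sum_{1\le i<j\le n}(-1)^i\theta(u_1,\dots,\hat u_i,\dots,u_{j-1},\rho(Tu_i)u_j,u_{j+1},\dots,u_n)$,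 $\Omega f(u_1,\dots,u_n)=(-1)^n\big(f_{\mathfrak g}(Tu_1,\dots,Tu_n)-\mathfrak Tf_V(Tu_1,\dots,Tu_{n-1},u_n)\big)$. *)

(* Defs.v *)
From HB Require Import structures.
From mathcomp Require Import all_boot all_order all_algebra.
From mathcomp Require Import sesquilinear ring_quotient generic_quotient.
From mathcomp Require Import boolp classical_sets functions.

Set Implicit Arguments.
Unset Strict Implicit.
Unset Printing Implicit Defensive.

Import GRing.Theory.
Local Open Scope ring_scope.
Local Open Scope quotient_scope.

Record lieAlgebra (K : fieldType) := LieAlgebra {
  lie_car :> lmodType K;
  lie_br : {bilinear lie_car -> lie_car -> lie_car};
  lie_alt : forall x, lie_br x x = 0;
  lie_jacobi : forall x y z,
    lie_br x (lie_br y z) + lie_br y (lie_br z x) + lie_br z (lie_br x y) = 0 }.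

(* The action [rho : g -> gl(V)] is given in uncurried form,
   [rep_act V x v = rho x v]. *)
Record lieRep (K : fieldType) (g : lieAlgebra K) := LieRep {
  rep_car :> lmodType K;
  rep_act : {bilinear g -> rep_car -> rep_car};
  rep_br : forall x y v,
    rep_act (lie_br _ x y) v =
      rep_act x (rep_act y v) - rep_act y (rep_act x v) }.

Record lieLeibniz (K : fieldType) := LieLeibniz {
  llg : lieAlgebra K;
  llV : lieRep llg;
  llT : {linear llV -> llg};
  llTP : forall u v, lie_br _ (llT u) (llT v) = llT (rep_act llV (llT u) v) }.

Record llHom (K : fieldType) (A B : lieLeibniz K) := LLHom {
  hom_g : {linear llg A -> llg B};
  hom_V : {linear llV A -> llV B};
  hom_br : forall x y, hom_g (lie_br _ x y) = lie_br _ (hom_g x) (hom_g y);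
  hom_T : forall u, llT B (hom_V u) = hom_g (llT A u);
  hom_act : forall x u,
    hom_V (rep_act (llV A) x u) = rep_act (llV B) (hom_g x) (hom_V u) }.

Definition is_llIso (K : fieldType) (A B : lieLeibniz K) (f : llHom A B) :=
  bijective (hom_g f) /\ bijective (hom_V f).

Section TrivialTriple.
Variable K : fieldType.

Definition zero2 (U V X : lmodType K) : U -> V -> X := fun _ _ => 0.

Fact zero2_bilinear (U V X : lmodType K) :
  bilinear_for *:%R *:%R (@zero2 U V X).
Proof. by split=> u a x y; rewrite /= /zero2 scaler0 addr0. Qed.

HB.instance Definition _ (U V X : lmodType K) :=
  bilinear_isBilinear.Build K U V X *:%R *:%R (@zero2 U V X)
    (@zero2_bilinear U V X).

Fact zero_jacobi (h : lmodType K) (x y z : h) :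
  zero2 h x (zero2 h y z) + zero2 h y (zero2 h z x)
  + zero2 h z (zero2 h x y) = 0 :> h.
Proof. by rewrite /zero2 !addr0. Qed.

Definition abelianLie (h : lmodType K) : lieAlgebra K :=
  @LieAlgebra K h (@zero2 h h h) (fun=> erefl) (@zero_jacobi h).

Fact zero_rep (h W : lmodType K) (x y : h) (v : W) :
  zero2 W (zero2 h x y) v =
    zero2 W x (zero2 W y v) - zero2 W y (zero2 W x v) :> W.
Proof. by rewrite /zero2 subr0. Qed.

Definition zeroRep (h W : lmodType K) : lieRep (abelianLie h) :=
  @LieRep K (abelianLie h) W (@zero2 h W W) (@zero_rep h W).

Fact zero_llTP (h W : lmodType K) (TT : {linear W -> h}) (u v : W) :
  zero2 h (TT u) (TT v) = TT (zero2 W (TT u) v).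
Proof. by rewrite /zero2 linear0. Qed.

Definition trivialTriple (h W : lmodType K) (TT : {linear W -> h}) :=
  @LieLeibniz K (abelianLie h) (zeroRep h W) TT (zero_llTP TT).

End TrivialTriple.

Definition short_exact (K : fieldType) (X Y Z : lmodType K)
    (i : {linear X -> Y}) (p : {linear Y -> Z}) :=
  [/\ injective i,
      forall y, p y = 0 <-> exists x, i x = y
    & forall z, exists y, p y = z].

Section Extensions.
Variables (K : fieldType) (A : lieLeibniz K) (h W : lmodType K).
Variable TT : {linear W -> h}.

Record extension := Extension {
  ext :> lieLeibniz K;
  ext_i : llHom (trivialTriple TT) ext;
  ext_p : llHom ext A;
  ext_exact_g : short_exact (hom_g ext_i) (hom_g ext_p);
  ext_exact_V : short_exact (hom_V ext_i) (hom_V ext_p) }.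

(* [h] and [W] are identified with their images under [ext_i]. *)
Definition is_central (E : extension) :=
  [/\ forall (a : h) (x : llg E), lie_br _ (hom_g (ext_i E) a) x = 0,
      forall (x : llg E) (xi : W),
        rep_act (llV E) x (hom_V (ext_i E) xi) = 0
    & forall (a : h) (u : llV E),
        rep_act (llV E) (hom_g (ext_i E) a) u = 0].

Record centralExt := CentralExt {
  cext :> extension;
  cextP : is_central cext }.

Definition ext_iso (E F : centralExt) : Prop :=
  exists f : llHom E F,
    [/\ is_llIso f,
        (forall a, hom_g f (hom_g (ext_i E) a) = hom_g (ext_i F) a),
        (forall xi, hom_V f (hom_V (ext_i E) xi) = hom_V (ext_i F) xi),
        (forall x, hom_g (ext_p F) (hom_g f x) = hom_g (ext_p E) x)
      & (forall u, hom_V (ext_p F) (hom_V f u) = hom_V (ext_p E) u)].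

(* An isomorphism class is the collection of all central extensions isomorphic
   to a given one. *)
Definition iso_classes :=
  {C : centralExt -> Prop | exists E, C = ext_iso E}.

Definition iso_class (E : centralExt) : iso_classes :=
  exist _ (ext_iso E) (ex_intro _ E erefl).

Record ext_section (E : extension) := ExtSection {
  sec_g : {linear llg A -> llg E};
  sec_V : {linear llV A -> llV E};
  sec_gK : forall x, hom_g (ext_p E) (sec_g x) = x;
  sec_VK : forall u, hom_V (ext_p E) (sec_V u) = u }.

End Extensions.

(* [Hom(/\^n U, Y)] is rendered as the space of alternating [n]-linear maps and
   [Hom((x)^n U, Y)] as that of [n]-linear maps, on families ['I_n -> U]. *)
Definition multilinear (K : fieldType) (U Y : lmodType K) (n : nat)
    (f : ('I_n -> U) -> Y) :=
  forall (i : 'I_n) (x : 'I_n -> U), linear (fun u => f [eta x with i |-> u]).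

Definition alternating (K : fieldType) (U Y : lmodType K) (n : nat)
    (f : ('I_n -> U) -> Y) :=
  forall (x : 'I_n -> U) (i j : 'I_n), i != j -> x i = x j -> f x = 0.

Fact multilinearB (K : fieldType) (U Y : lmodType K) (n : nat)
    (f f' : ('I_n -> U) -> Y) :
  multilinear f -> multilinear f' -> multilinear (f - f').
Proof.
move=> Hf Hf' i x a u v; have e := Hf i x a u v; have e' := Hf' i x a u v.
by rewrite /= in e e'; rewrite !fctE /= e e' scalerBr opprD addrACA.
Qed.

Fact alternatingB (K : fieldType) (U Y : lmodType K) (n : nat)
    (f f' : ('I_n -> U) -> Y) :
  alternating f -> alternating f' -> alternating (f - f').
Proof.
move=> Hf Hf' x i j ij xij.
by rewrite !fctE /= (Hf x i j) // (Hf' x i j) // subr0.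
Qed.

Fact multilinear0 (K : fieldType) (U Y : lmodType K) (n : nat) :
  multilinear (0 : ('I_n -> U) -> Y).
Proof. by move=> i x a u v; rewrite /= scaler0 addr0. Qed.

(* [omit x i] is [(x_1, .., ^x_i, .., x_(n+1))]. *)
Definition omit (U : Type) (n : nat) (x : 'I_n.+1 -> U) (i : 'I_n.+1) :
  'I_n -> U := fun k => x (lift i k).

(* [contract m x i j] is [x] with [x_i] omitted and [x_j] replaced by
   [m x_i x_j]. *)
Definition contract (U : Type) (m : U -> U -> U) (n : nat)
    (x : 'I_n.+1 -> U) (i j : 'I_n.+1) : 'I_n -> U :=
  omit [eta x with j |-> m (x i) (x j)] i.

Section Cohomology.
Variables (K : fieldType) (A : lieLeibniz K) (h W : lmodType K).
Variable TT : {linear W -> h}.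

Local Notation g := (llg A).
Local Notation V := (llV A).
Local Notation rho := (rep_act (llV A)).
Local Notation T := (llT A).

(* Underlying functions of the cochains of degree [m.+1]: the three components
   of [((f_g, f_V), theta)]. *)
Definition triFun (m : nat) : lmodType K :=
  (((('I_m.+1 -> g) -> h) * (('I_m -> g) -> V -> W)) * (('I_m -> V) -> h))%type.

Definition is_triCochain (m : nat) (c : triFun m) : Prop :=
  [/\ multilinear c.1.1 /\ alternating c.1.1,
      [/\ forall v, multilinear (fun x => c.1.2 x v),
          forall v, alternating (fun x => c.1.2 x v)
        & forall x, linear (c.1.2 x)]
    & multilinear c.2].

(* Indices below start at 0, hence the exponents of the signs are shifted by
   one with respect to indices starting at 1. *)
Definition delta_g (m : nat) (f : ('I_m.+1 -> g) -> h) :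
    ('I_m.+2 -> g) -> h := fun x =>
  \sum_(i < m.+2) \sum_(j < m.+2 | (i < j)%N)
    (-1) ^+ i.+1 *: f (contract (lie_br g) x i j).

Definition delta_V (m : nat) (f : ('I_m -> g) -> V -> W) :
    ('I_m.+1 -> g) -> V -> W := fun x v =>
  \sum_(i < m.+1) \sum_(j < m.+1 | (i < j)%N)
    (-1) ^+ i.+1 *: f (contract (lie_br g) x i j) v
  - \sum_(i < m.+1) (-1) ^+ i *: f (omit x i) (rho (x i) v).

Definition partial (m : nat) (theta : ('I_m -> V) -> h) :
    ('I_m.+1 -> V) -> h := fun u =>
  \sum_(i < m.+1) \sum_(j < m.+1 | (i < j)%N)
    (-1) ^+ i.+1 *: theta (contract (fun a b => rho (T a) b) u i j).

Definition Omega (m : nat)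
    (f : (('I_m.+1 -> g) -> h) * (('I_m -> g) -> V -> W)) :
    ('I_m.+1 -> V) -> h := fun u =>
  (-1) ^+ m.+1 *: (f.1 (fun k => T (u k))
                   - TT (f.2 (fun k => T (omit u ord_max k)) (u ord_max))).

Definition D_R (m : nat) (c : triFun m) : triFun m.+1 :=
  ((delta_g c.1.1, delta_V c.1.2), partial c.2 + Omega c.1).

(* From here on [n] is the actual degree, with [C^0 = 0]. [cochainFun n] is the
   ambient space of functions, in which [C^n] is the subspace [is_cochain]. *)
Definition cochainFun (n : nat) : lmodType K :=
  if n is m.+1 then triFun m else 'rV[K]_0.

Definition is_cochain (n : nat) : cochainFun n -> Prop :=
  match n with 0 => fun _ => True | m.+1 => @is_triCochain m end.

Definition D (n : nat) : cochainFun n -> cochainFun n.+1 :=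
  match n with 0 => fun _ => 0 | m.+1 => @D_R m end.

Definition is_cocycle (n : nat) : {pred cochainFun n} :=
  fun c => `[< is_cochain c /\ D c = 0 >].

Definition is_coboundary (n : nat) : cochainFun n -> Prop :=
  match n with
  | 0 => fun c => c = 0
  | m.+1 => fun c => exists2 b : cochainFun m, is_cochain b & c = D b
  end.

Fact is_triCochainB m (c d : triFun m) :
  is_triCochain c -> is_triCochain d -> is_triCochain (c - d).
Proof.
move=> [[a1 a2] [b1 b2 b3] c1] [[a1' a2'] [b1' b2' b3'] c1']; split.
- by split; [exact: multilinearB | exact: alternatingB].
- split=> [v|v|x].
  + exact: (multilinearB (b1 v) (b1' v)).
  + exact: (alternatingB (b2 v) (b2' v)).
  + move=> a u v; have e := b3 x a u v; have e' := b3' x a u v.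
    by rewrite /= !fctE /= e e' scalerBr opprD addrACA.
- exact: multilinearB.
Qed.

Fact is_triCochain0 m : is_triCochain (0 : triFun m).
Proof.
split; first by split=> //; exact: multilinear0.
- split=> // [v|x a u v]; first exact: multilinear0.
  by rewrite /= scaler0 addr0.
- exact: multilinear0.
Qed.

Fact delta_gB m (f f' : ('I_m.+1 -> g) -> h) :
  delta_g (f - f') = delta_g f - delta_g f'.
Proof.
apply/funext => x; rewrite !fctE /delta_g -sumrB; apply: eq_bigr => i _.
by rewrite -sumrB; apply: eq_bigr => j _; rewrite -scalerBr.
Qed.

Fact delta_VB m (f f' : ('I_m -> g) -> V -> W) :
  delta_V (f - f') = delta_V f - delta_V f'.
Proof.
apply/funext => x; apply/funext => v; rewrite !fctE /delta_V.
rewrite opprD addrACA -opprD; congr (_ - _).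
  rewrite -sumrB; apply: eq_bigr => i _.
  by rewrite -sumrB; apply: eq_bigr => j _; rewrite -scalerBr.
by rewrite -sumrB; apply: eq_bigr => i _; rewrite -scalerBr.
Qed.

Fact partialB m (t t' : ('I_m -> V) -> h) :
  partial (t - t') = partial t - partial t'.
Proof.
apply/funext => x; rewrite !fctE /partial -sumrB; apply: eq_bigr => i _.
by rewrite -sumrB; apply: eq_bigr => j _; rewrite -scalerBr.
Qed.

Fact OmegaB m (f f' : (('I_m.+1 -> g) -> h) * (('I_m -> g) -> V -> W)) :
  Omega (f - f') = Omega f - Omega f'.
Proof.
apply/funext => x; rewrite !fctE /Omega -scalerBr; congr (_ *: _).
by rewrite /= !fctE linearB /= opprD addrACA -opprD.
Qed.

Fact D_RB m (c d : triFun m) : D_R (c - d) = D_R c - D_R d.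
Proof.
by rewrite /D_R /= delta_gB delta_VB partialB OmegaB addrACA -opprD.
Qed.

Fact is_cochainB n (c d : cochainFun n) :
  is_cochain c -> is_cochain d -> is_cochain (c - d).
Proof. by case: n c d => [//|m] c d; exact: is_triCochainB. Qed.

Fact is_cochain0 n : is_cochain (0 : cochainFun n).
Proof. by case: n => [//|m]; exact: is_triCochain0. Qed.

Fact DB n (c d : cochainFun n) : D (c - d) = D c - D d.
Proof. by case: n c d => [c d|m c d]; [rewrite subr0 | exact: D_RB]. Qed.

Fact D0 n : D (0 : cochainFun n) = 0.
Proof. by rewrite -(subrr (0 : cochainFun n)) DB subrr. Qed.

Fact is_cocycle_zmod n : zmod_closed (@is_cocycle n).
Proof.
split=> [|c d /asboolP [cC c0] /asboolP [dC d0]]; apply/asboolP.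
  by split; [exact: is_cochain0 | exact: D0].
by split; [exact: is_cochainB | rewrite DB c0 d0 subr0].
Qed.

HB.instance Definition _ n :=
  GRing.isZmodClosed.Build (cochainFun n) (@is_cocycle n) (is_cocycle_zmod n).

Record cocycle (n : nat) := Cocycle {
  cocycle_val :> cochainFun n;
  cocycleP : cocycle_val \in @is_cocycle n }.

HB.instance Definition _ n := [isSub for @cocycle_val n].
HB.instance Definition _ n := [Choice of cocycle n by <:].
HB.instance Definition _ n := [SubChoice_isSubZmodule of cocycle n by <:].

(* The cocycles lying in the image of [D], so that [cohomology n] is [Z^n/B^n];
   this reading needs no prior proof that [D] preserves cochains or squares
   to 0. *)
Definition coboundary (n : nat) : {pred cocycle n} :=
  fun c => `[< is_coboundary (val c) >].

Fact coboundary_zmod n : zmod_closed (@coboundary n).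
Proof.
case: n => [|m]; split.
- exact/asboolP.
- move=> c d /asboolP /= c0 /asboolP /= d0; apply/asboolP.
  by rewrite /= c0 d0 subr0.
- by apply/asboolP; exists 0; [exact: is_cochain0 | rewrite D0].
- move=> c d /asboolP [b bC bE] /asboolP [b' b'C b'E]; apply/asboolP.
  by exists (b - b'); [exact: is_cochainB | rewrite DB -bE -b'E].
Qed.

HB.instance Definition _ n :=
  GRing.isZmodClosed.Build (cocycle n) (@coboundary n) (coboundary_zmod n).

Definition cohomology (n : nat) : zmodType := Quotient.quot (@coboundary n).

Definition coh_class (n : nat) (c : cocycle n) : cohomology n :=
  \pi_(Quotient.quot (@coboundary n)) c.

Section AssociatedCocycle.
Variables (E : extension A TT) (s : ext_section E).

(* Inverses of the inclusions [h -> ext] and [W -> ext] on their images (and 0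
   elsewhere). *)
Definition pull_g (x : llg E) : h := xget 0 [set a | hom_g (ext_i E) a = x].
Definition pull_V (u : llV E) : W := xget 0 [set xi | hom_V (ext_i E) xi = u].

Definition omega (x y : g) : h :=
  pull_g (lie_br _ (sec_g s x) (sec_g s y) - sec_g s (lie_br _ x y)).

Definition varpi (x : g) (u : V) : W :=
  pull_V (rep_act (llV E) (sec_g s x) (sec_V s u) - sec_V s (rho x u)).

Definition calT (u : V) : h :=
  pull_g (llT E (sec_V s u) - sec_g s (T u)).

Definition section_cochain : cochainFun 2 :=
  ((fun x : 'I_2 -> g => omega (x ord0) (x ord_max),
    fun x : 'I_1 -> g => varpi (x ord0)),
   fun u : 'I_1 -> V => calT (u ord0)).

End AssociatedCocycle.

End Cohomology.

(* Main.v *)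
(* A section of a central extension writes its elements as s x + a with a in the
   kernel, so the extension is determined by (omega, varpi, calT); the axioms of
   a Lie-Leibniz triple for the total space are exactly the closedness of that
   cochain, and on the product g x h, V x W every cocycle defines an extension.
   Changing the section by (a, b) in Hom(g, h) + Hom(V, W) changes the cocycle by
   the coboundary of (a, b, 0), while C^1 has the further summand h, on which the
   differential vanishes. Sections exist, in any dimension, by Zorn's lemma. *)
Require Import Defs.
From mathcomp Require Import all_boot all_algebra.
From HB Require Import structures.
From mathcomp Require Import sesquilinear ring_quotient generic_quotient.
From mathcomp Require Import boolp classical_sets functions.

Set Implicit Arguments.
Unset Strict Implicit.
Unset Printing Implicit Defensive.

Import GRing.Theory.
Local Open Scope ring_scope.

(** * Splitting surjective linear maps in arbitrary dimension *)

Section LinearAlgebra.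
Variable K : fieldType.

Definition pack_linear (U V : lmodType K) (f : U -> V) (lf : linear f) :
    {linear U -> V} :=
  HB.pack f (GRing.isLinear.Build K U V *:%R f lf).

Definition pack_bilinear (U V X : lmodType K) (f : U -> V -> X)
    (bf : bilinear_for *:%R *:%R f) : {bilinear U -> V -> X} :=
  HB.pack f (bilinear_isBilinear.Build K U V X *:%R *:%R f bf).

(* A subspace maximal among those meeting the kernel trivially is a complement
   of the kernel; the empty set is admitted only so that Zorn's lemma applies
   to the empty chain. *)
Lemma linear_section (Y Z : lmodType K) (p : {linear Y -> Z}) :
  (forall z, exists y, p y = z) -> exists s : {linear Z -> Y}, cancel s p.
Proof.
move=> surj_p.
pose P (S : set Y) :=
  (forall a u v, S u -> S v -> S (a *: u + v)) /\
  (forall u, S u -> p u = 0 -> u = 0).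
have [|S [[S_lin S_ker] maxS]] := @Zorn_bigcup Y P.
  move=> F FP totF; split=> [a u v [X FX Xu] [X' FX' X'v]|u [X FX Xu]].
    have [XX'|X'X] := totF _ _ FX FX'.
      by exists X' => //; apply: (FP _ FX').1 => //; apply: XX'.
    by exists X => //; apply: (FP _ FX).1 => //; apply: X'X.
  exact: (FP _ FX).2.
have S0 : S 0.
  apply: contrapT => nS0; have Se u : ~ S u.
    by move=> Su; apply: nS0; have := S_lin (-1) _ _ Su Su; rewrite scaleN1r addNr.
  refine (maxS [set 0]%classic _ _); last first.
    by split=> [a u v -> ->|u //]; rewrite scaler0 addr0.
  split=> [|sub]; first by move=> u /Se.
  by apply: nS0; apply: sub.
have SZ a u : S u -> S (a *: u) by move=> Su; rewrite -[_ *: _]addr0; apply: S_lin.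
have SB u v : S u -> S v -> S (u - v).
  by move=> Su Sv; rewrite addrC -scaleN1r; apply: S_lin.
(* If [z] were missed by [p] on [S], then [S] enlarged by the line through a preimage [y0] of [z]
   would still meet the kernel trivially, against maximality. *)
have Ssurj z : exists y, S y /\ p y = z.
  have [y0 py0] := surj_p z; apply: contrapT => nz.
  pose S' := [set y : Y | exists2 u, S u & exists b : K, y = u + b *: y0]%classic.
  (* For [b] nonzero the equation reads [p u = - b *: z], so [- b^-1 *: u] would be a preimage of
     [z] in [S]. *)
  have Sb u b : S u -> p (u + b *: y0) = 0 -> b = 0.
    move=> Su e; apply: contrapT => /eqP b0; apply: nz; exists (- b^-1 *: u).
    split; first exact: SZ.
    rewrite linearZ /= -[p u](addrK (b *: p y0)) -linearZ -linearD e add0r.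
    by rewrite scaleNr scalerN opprK linearZ /= scalerA mulVf // scale1r.
  refine (maxS S' _ _).
    split=> [u Su|sub]; first by exists u => //; exists 0; rewrite scale0r addr0.
    apply: nz; exists y0; split=> //; apply: sub.
    by exists 0 => //; exists 1; rewrite scale1r add0r.
  split=> [a _ _ [u Su [b ->]] [v Sv [c ->]]|_ [u Su [b ->]] e].
    exists (a *: u + v); first exact: S_lin.
    by exists (a * b + c); rewrite scalerDr scalerA scalerDl addrACA.
  have b0 := Sb _ _ Su e; rewrite b0 scale0r addr0 in e *; exact: S_ker.
have [s sP] := choice Ssurj.
(* [p] is injective on [S], so the chosen preimages are forced; linearity of [s] follows because [S]
   is closed under linear combinations. *)
have sU y : S y -> s (p y) = y.
  move=> Sy; apply/eqP; rewrite -subr_eq0; apply/eqP; apply: S_ker.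
    by apply: SB => //; apply: (sP _).1.
  by rewrite linearB /= (sP _).2 subrr.
have s_lin : linear s.
  move=> a u v; have [[Su eu] [Sv ev]] := (sP u, sP v).
  by rewrite -{1}eu -{1}ev -linearP sU //; apply: S_lin.
by exists (pack_linear s_lin) => z; apply: (sP z).2.
Qed.

End LinearAlgebra.

(** * Cochains of low degree *)

Section Families.

(** Families of length 2 and 3 are written out by entries, so that cochains of low degree can be
    handled as functions of separate variables. *)
Definition pair2 (U : Type) (a b : U) : 'I_2 -> U :=
  fun k => if k == ord0 then a else b.

Lemma ord2P (i : 'I_2) : i = ord0 \/ i = ord_max.
Proof. by case: i => [[|[|]]// ?]; [left|right]; apply/val_inj. Qed.

Lemma pair2_eta (U : Type) (x : 'I_2 -> U) : pair2 (x ord0) (x ord_max) = x.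
Proof.
apply/funext => k; rewrite /pair2; case: eqP => [->//|/eqP k0].
by congr x; apply/val_inj; case: k k0 => [[|[|]]].
Qed.

Lemma family1_eta (U : Type) (x : 'I_1 -> U) : (fun=> x ord0) = x.
Proof. by apply/funext => k; rewrite [k]ord1. Qed.

(** Through this the [V]-part of a 1-cochain amounts to a single linear map from [V] to [W]. *)
Lemma family0_unique (U : Type) (x y : 'I_0 -> U) : x = y.
Proof. by apply/funext => -[]. Qed.

Definition triple3 (U : Type) (a b c : U) : 'I_3 -> U :=
  fun k => if k == ord0 then a else if k == ord_max then c else b.

Definition ord31 : 'I_3 := lift ord0 ord0.

Lemma triple3_eta (U : Type) (x : 'I_3 -> U) :
  triple3 (x ord0) (x ord31) (x ord_max) = x.
Proof.
apply/funext => k; rewrite /triple3.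
case: (k =P ord0) => [->//|/eqP k0]; case: (k =P ord_max) => [->//|/eqP k2].
by apply: (congr1 x); apply/val_inj; case: k k0 k2 => [[|[|[|]]]].
Qed.

Lemma sum_lt2 (M : nmodType) (F : 'I_2 -> 'I_2 -> M) :
  \sum_(i < 2) \sum_(j < 2 | (i < j)%N) F i j = F ord0 ord_max.
Proof.
under eq_bigr do rewrite big_mkcond /=.
rewrite !(big_ord_recl, big_ord0) /= !(addr0, add0r).
by congr F; apply/val_inj.
Qed.

Lemma sum_lt3 (M : nmodType) (F : 'I_3 -> 'I_3 -> M) :
  \sum_(i < 3) \sum_(j < 3 | (i < j)%N) F i j =
    F ord0 ord31 + F ord0 ord_max + F ord31 ord_max.
Proof.
under eq_bigr do rewrite big_mkcond /=.
rewrite !(big_ord_recl, big_ord0) /= !(addr0, add0r).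
by congr (_ + F _ _ + F _ _); apply/val_inj.
Qed.

Variables (U : Type) (m : U -> U -> U).

Lemma contract_pair2 a b :
  contract m (pair2 a b) ord0 ord_max = (fun=> m a b).
Proof. by apply/funext => k; rewrite [k]ord1. Qed.

Lemma contract_triple3_01 a b c :
  contract m (triple3 a b c) ord0 ord31 = pair2 (m a b) c.
Proof. by apply/funext => k; case: (ord2P k) => ->. Qed.

Lemma contract_triple3_02 a b c :
  contract m (triple3 a b c) ord0 ord_max = pair2 b (m a c).
Proof. by apply/funext => k; case: (ord2P k) => ->. Qed.

Lemma contract_triple3_12 a b c :
  contract m (triple3 a b c) ord31 ord_max = pair2 a (m b c).
Proof. by apply/funext => k; case: (ord2P k) => ->. Qed.

End Families.

Section Cochains.
Variables (K : fieldType) (A : lieLeibniz K) (h W : lmodType K).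
Variable TT : {linear W -> h}.

Local Notation g := (llg A).
Local Notation V := (llV A).
Local Notation br := (lie_br (llg A)).
Local Notation rho := (rep_act (llV A)).
Local Notation T := (llT A).

(** The last three fields are the three components of closedness; they are what the Jacobi identity,
    the representation identity and the identity for [T] demand of the structure twisted by [om],
    [vp] and [th]. *)
Record is_cocycle2 (om : g -> g -> h) (vp : g -> V -> W) (th : V -> h) : Prop := {
  om_bilinear : bilinear_for *:%R *:%R om;
  om_alt : forall x, om x x = 0;
  vp_bilinear : bilinear_for *:%R *:%R vp;
  th_linear : linear th;
  om_jacobi : forall x y z, om x (br y z) = om (br x y) z + om y (br x z);
  vp_rep : forall x y v, vp (br x y) v = vp x (rho y v) - vp y (rho x v);
  th_T : forall u v, om (T u) (T v) - TT (vp (T u) v) = th (rho (T u) v) }.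

Definition cochain2 (om : g -> g -> h) (vp : g -> V -> W) (th : V -> h) :
    cochainFun A h W 2 :=
  ((fun x : 'I_2 -> g => om (x ord0) (x ord_max),
    fun x : 'I_1 -> g => vp (x ord0)),
   fun u : 'I_1 -> V => th (u ord0)).

Lemma cochain2_eta (c : cochainFun A h W 2) :
  c = cochain2 (fun x y => c.1.1 (pair2 x y)) (fun x => c.1.2 (fun=> x))
        (fun u => c.2 (fun=> u)).
Proof.
case: c => -[f1 f2] f3; congr (_, _, _); apply/funext => x /=.
- by rewrite pair2_eta.
- by rewrite family1_eta.
- by rewrite family1_eta.
Qed.

Lemma is_cochain2P om vp th :
  is_cochain (cochain2 om vp th) <->
  [/\ bilinear_for *:%R *:%R om, forall x, om x x = 0,
      bilinear_for *:%R *:%R vp & linear th].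
Proof.
split=> [[[/= om_lin om_alt] [vp_linl _ vp_linr] th_lin]|].
  split.
  - split=> [y|x] a u v.
    (* The entry in the varied slot is overwritten, so 0 is only a placeholder there and in the
       cases below. *)
    + exact: (om_lin ord0 (pair2 0 y)).
    + exact: (om_lin ord_max (pair2 x 0)).
  - by move=> x; apply: (om_alt (fun=> x) ord0 ord_max).
  - split=> [v|x] a u u'; last exact: vp_linr (fun=> x) a u u'.
    exact: (vp_linl v ord0 (fun=> 0)).
  - by move=> a u v; apply: (th_lin ord0 (fun=> 0)).
move=> [[om_l om_r] om_alt [vp_l vp_r] th_lin]; split => /=.
- split=> [i x a u v|x i j]; last first.
    move=> ij xij; rewrite (_ : x ord0 = x ord_max) ?om_alt //.
    by case: (ord2P i) (ord2P j) xij ij => -> [] -> //; rewrite eqxx.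
  case: (ord2P i) => -> /=; [exact: om_l|exact: om_r].
- split=> [v i x a u w|v x i j|x]; last exact: vp_r.
  + by rewrite [i]ord1 /=; apply: vp_l.
  + by rewrite [i]ord1 [j]ord1.
- by move=> i x a u v; rewrite [i]ord1 /=; apply: th_lin.
Qed.

(** Evaluated on written-out families, each component of the differential is, up to sign, the
    difference of the two sides of one identity. The sign in [Omega] is +1 in this degree. *)
Lemma D_cochain2P om vp th :
  (D TT (cochain2 om vp th) = 0) <->
  [/\ forall x y z, om x (br y z) = om (br x y) z + om y (br x z),
      forall x y v, vp (br x y) v = vp x (rho y v) - vp y (rho x v)
    & forall u v, om (T u) (T v) - TT (vp (T u) v) = th (rho (T u) v)].
Proof.
have Eg x y z : (D TT (cochain2 om vp th)).1.1 (triple3 x y z) =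
    om x (br y z) - (om (br x y) z + om y (br x z)).
  rewrite /= /delta_g sum_lt3.
  rewrite contract_triple3_01 contract_triple3_02 contract_triple3_12.
  rewrite expr1 exprS expr1 mulrNN mulr1 !scaleN1r scale1r.
  by rewrite addrC -opprD.
have EV x y v : (D TT (cochain2 om vp th)).1.2 (pair2 x y) v =
    vp x (rho y v) - vp y (rho x v) - vp (br x y) v.
  rewrite /= /delta_V sum_lt2 contract_pair2 !(big_ord_recl, big_ord0) /=.
  by rewrite addr0 expr1 expr0 scaleN1r scale1r scaleN1r opprB addrC.
have ET u v : (D TT (cochain2 om vp th)).2 (pair2 u v) =
    om (T u) (T v) - TT (vp (T u) v) - th (rho (T u) v).
  rewrite /= !fctE /= /partial /Omega sum_lt2 contract_pair2.
  by rewrite expr1 expr2 mulrNN mulr1 scaleN1r scale1r addrC.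
split=> [c0|[om_jacobi vp_rep th_T]].
  split=> [x y z|x y v|u v]; apply/eqP.
  - by rewrite -subr_eq0 -Eg c0.
  - by rewrite eq_sym -subr_eq0 -EV c0.
  - by rewrite -subr_eq0 -ET c0.
rewrite [LHS]surjective_pairing [_.1]surjective_pairing.
congr (_, _, _); apply/funext => x.
- by rewrite -[x]triple3_eta Eg om_jacobi subrr.
- by apply/funext => v; rewrite -[x]pair2_eta EV vp_rep subrr.
- by rewrite -[x]pair2_eta ET th_T subrr.
Qed.

Lemma is_coboundary2P om vp th :
  is_coboundary TT (cochain2 om vp th) <->
  exists (a : {linear g -> h}) (b : {linear V -> W}),
    [/\ forall x y, om x y = - a (br x y), forall x v, vp x v = - b (rho x v)
      & forall u, th u = TT (b u) - a (T u)].
Proof.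
(* In degree 1 the third component [c.2] drops out: its [partial] is a sum over pairs [i < j] in a
   one-element index set. The sign in [Omega] is now -1, which puts [TT] first. *)
have E (c : cochainFun A h W 1) : D TT c =
    cochain2 (fun x y => - c.1.1 (fun=> br x y))
      (fun x v => - c.1.2 (fun=> 0) (rho x v))
      (fun u => TT (c.1.2 (fun=> 0) u) - c.1.1 (fun=> T u)).
  rewrite [LHS]cochain2_eta; congr (_, _, _); apply/funext => x.
  - by rewrite /= /delta_g sum_lt2 contract_pair2 expr1 scaleN1r.
  - apply/funext => v; rewrite /= /delta_V !(big_ord_recl, big_ord0) /=.
    rewrite big_mkcond !(big_ord_recl, big_ord0) /= !addr0 add0r scale1r.
    by rewrite (family0_unique (omit _ _) (fun=> 0)).
  - rewrite /= !fctE /= /partial /Omega !(big_ord_recl, big_ord0) /=.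
    rewrite big_mkcond !(big_ord_recl, big_ord0) /= !addr0 add0r.
    by rewrite expr1 scaleN1r opprB (family0_unique (fun _ => T _) (fun=> 0)).
split=> [[c [[a_lin _] [_ _ b_lin] _] ec]|[a [b [oE vE tE]]]].
  have a_lin' : linear (fun x : g => c.1.1 (fun=> x)).
    move=> k u v; have := a_lin ord0 (fun=> 0) k u v => /=.
    by congr (c.1.1 _ = _ *: c.1.1 _ + c.1.1 _); apply/funext => i; rewrite [i]ord1.
  exists (pack_linear a_lin'), (pack_linear (b_lin (fun=> 0))).
  rewrite E in ec; split=> [x y|x v|u].
  - exact: (congr1 (fun d : cochainFun A h W 2 => d.1.1 (pair2 x y)) ec).
  - exact: (congr1 (fun d : cochainFun A h W 2 => d.1.2 (fun=> x) v) ec).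
  - exact: (congr1 (fun d : cochainFun A h W 2 => d.2 (fun=> u)) ec).
pose c : cochainFun A h W 1 :=
  ((fun x : 'I_1 -> g => a (x ord0), fun (_ : 'I_0 -> g) v => b v),
   fun _ : 'I_0 -> V => 0).
exists c.
  split=> /=.
  - by split=> [i x k u v|x i j]; rewrite [i]ord1 ?[j]ord1 //= linearP.
  - by split=> [v [] []|v x [] []|x k u v] //; rewrite linearP.
  - by case.
rewrite E; congr (_, _, _); apply/funext => x.
- exact: oE.
- by apply/funext => v; exact: vE.
- exact: tE.
Qed.

End Cochains.

(** * Extensions with a section *)

Section SplitExact.
Variables (K : fieldType) (X Y Y' Z : lmodType K).
Variables (i : {linear X -> Y}) (p : {linear Y -> Z}) (s : {linear Z -> Y}).
Variables (i' : {linear X -> Y'}) (t : {linear Z -> Y'}).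
Hypotheses (ip : short_exact i p) (ps : cancel s p).

Lemma exact_comp0 x : p (i x) = 0.
Proof. by case: ip => _ /(_ (i x)) [_ + _]; apply; exists x. Qed.

(** On the kernel of [p] exactness supplies a preimage, so the default value 0 of [xget] is never
    taken for lack of one. *)
Lemma pull_exactK y : p y = 0 -> i (xget 0 [set x | i x = y]%classic) = y.
Proof.
move=> py0; have [_ /(_ y) [/(_ py0) ex _] _] := ip.
exact: (xgetPex (P := [set x | i x = y]%classic) 0 ex).
Qed.

Lemma split_exactP y : exists z x, y = s z + i x.
Proof.
exists (p y), (xget 0 [set x | i x = y - s (p y)]%classic).
by rewrite pull_exactK ?subrKC// linearB /= ps subrr.
Qed.

(** The map taking [s z + i x] to [t z + i' x]; the coordinates of [y] are recovered as [z = p y]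
    and [x] the preimage of [y - s (p y)]. *)
Definition transfer (y : Y) : Y' :=
  t (p y) + i' (xget 0 [set x | i x = y - s (p y)]%classic).

Lemma transferE z x : transfer (s z + i x) = t z + i' x.
Proof.
rewrite /transfer linearD /= ps exact_comp0 addr0 addrAC subrr add0r.
(* Injectivity of [i] determines the value chosen by [xget]. *)
congr (_ + i' _); apply: xget_unique => // x'.
by case: ip => i_inj _ _ /i_inj.
Qed.

Lemma transfer_linear : linear transfer.
Proof.
move=> a u v.
have [[z [x ->]] [z' [x' ->]]] := (split_exactP u, split_exactP v).
rewrite scalerDr addrACA -!linearP !transferE !linearP /=.
by rewrite scalerDr addrACA.
Qed.

Lemma transfer_incl x : transfer (i x) = i' x.
Proof. by rewrite -[i x]add0r -(linear0 s) transferE linear0 add0r. Qed.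

End SplitExact.

Section SplitExactInverse.
Variables (K : fieldType) (X Y Y' Z : lmodType K).
Variables (i : {linear X -> Y}) (p : {linear Y -> Z}) (s : {linear Z -> Y}).
Variables (i' : {linear X -> Y'}) (p' : {linear Y' -> Z}) (t : {linear Z -> Y'}).
Hypotheses (ip : short_exact i p) (ps : cancel s p).
Hypotheses (ip' : short_exact i' p') (pt : cancel t p').

Lemma transferK : cancel (transfer i p s i' t) (transfer i' p' t i s).
Proof.
by move=> y; have [z [x ->]] := split_exactP ip ps y; rewrite !transferE.
Qed.

Lemma transfer_proj y : p' (transfer i p s i' t y) = p y.
Proof.
have [z [x ->]] := split_exactP ip ps y; rewrite transferE // !linearD /=.
by rewrite ps pt (exact_comp0 ip) (exact_comp0 ip').
Qed.

End SplitExactInverse.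

(** * Direct products as split exact sequences *)

Section Products.
Variable K : fieldType.

Definition inr_lin (U X : lmodType K) (x : X) : (U * X)%type := (0, x).

Fact inr_linear U X : linear (@inr_lin U X).
Proof.
by move=> k u v; apply: injective_projections; rewrite //= scaler0 addr0.
Qed.

Definition inl_lin (U X : lmodType K) (u : U) : (U * X)%type := (u, 0).

Fact inl_linear U X : linear (@inl_lin U X).
Proof.
by move=> k u v; apply: injective_projections; rewrite //= scaler0 addr0.
Qed.

Lemma prod_short_exact (U X : lmodType K) :
  short_exact (pack_linear (@inr_linear U X)) (@fst U X).
Proof.
split=> [x y [] //|[u x]|u] /=; last by exists (u, 0).
by split=> [->|[y [<-]]] //; exists x.
Qed.

End Products.

(** * Antisymmetry and the Leibniz form of the Jacobi identity *)

Section LieFacts.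
Variables (K : fieldType).

Lemma linP (U V : lmodType K) (f : {linear U -> V}) a u v :
  f (a *: u + v) = a *: f u + f v.
Proof. exact: linearP. Qed.

Lemma bilPl (U V X : lmodType K) (f : {bilinear U -> V -> X}) a u v w :
  f (a *: u + v) w = a *: f u w + f v w.
Proof. exact: linearPl. Qed.

Lemma bilPr (U V X : lmodType K) (f : {bilinear U -> V -> X}) a u v w :
  f w (a *: u + v) = a *: f w u + f w v.
Proof. exact: linearP. Qed.

(** Polarization: expand [f (x + y) (x + y) = 0]. Stated for bare functions so as to serve both the
    bracket and the component [om] of a cocycle. *)
Lemma alternating2_anti (U Y : lmodType K) (f : U -> U -> Y) :
  bilinear_for *:%R *:%R f -> (forall x, f x x = 0) ->
  forall x y, f x y = - f y x.
Proof.
move=> bf f_alt x y; apply/eqP; rewrite -addr_eq0.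
have := f_alt (x + y); rewrite -[f]/(pack_bilinear bf : _ -> _ -> _).
by rewrite linearDl !linearD /= !f_alt add0r addr0 => ->.
Qed.

Variable g : lieAlgebra K.
Local Notation br := (lie_br g).

Lemma lie_anti x y : br x y = - br y x.
Proof.
by apply: alternating2_anti => //;
  [split=> [z|z] a u v; rewrite (linearPl, linearP) | exact: lie_alt].
Qed.

(** The Jacobi identity in the shape of the closedness condition [om_jacobi]. *)
Lemma lie_leibniz x y z : br x (br y z) = br (br x y) z + br y (br x z).
Proof.
have := lie_jacobi x y z.
rewrite [br z (br x y)]lie_anti [br z x]lie_anti linearN -addrA -opprD addrC.
by move=> /eqP; rewrite addrC subr_eq0 [X in _ == X]addrC => /eqP.
Qed.

End LieFacts.

(** * Central extensions in the coordinates of a section *)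

Section CentralExtensions.
Variables (K : fieldType) (A : lieLeibniz K) (h W : lmodType K).
Variable TT : {linear W -> h}.

Section OneSection.
Variables (E : centralExt A TT) (s : ext_section E).

Local Notation ig := (hom_g (ext_i E)).
Local Notation iV := (hom_V (ext_i E)).
Local Notation pg := (hom_g (ext_p E)).
Local Notation pV := (hom_V (ext_p E)).

Lemma incl_g_inj : injective ig. Proof. by case: (ext_exact_g E). Qed.
Lemma incl_V_inj : injective iV. Proof. by case: (ext_exact_V E). Qed.

Lemma central_brl (a : h) x : lie_br (llg E) (ig a) x = 0.
Proof. by case: (cextP E). Qed.
Lemma central_brr x (a : h) : lie_br (llg E) x (ig a) = 0.
Proof. by rewrite lie_anti central_brl oppr0. Qed.
Lemma central_actl (a : h) u : rep_act (llV E) (ig a) u = 0.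
Proof. by case: (cextP E). Qed.
Lemma central_actr x (xi : W) : rep_act (llV E) x (iV xi) = 0.
Proof. by case: (cextP E). Qed.

(** The projection is a homomorphism, hence kills the difference defining [omega], and [pull_g]
    returns a true preimage. The same argument gives [act_sec] and [T_sec]. *)
Lemma br_sec x y :
  lie_br (llg E) (sec_g s x) (sec_g s y) =
    sec_g s (lie_br (llg A) x y) + ig (omega s x y).
Proof.
rewrite [ig _](pull_exactK (ext_exact_g E)) ?subrKC// linearB /=.
by rewrite hom_br !sec_gK subrr.
Qed.

Lemma act_sec x u :
  rep_act (llV E) (sec_g s x) (sec_V s u) =
    sec_V s (rep_act (llV A) x u) + iV (varpi s x u).
Proof.
rewrite [iV _](pull_exactK (ext_exact_V E)) ?subrKC// linearB /=.
by rewrite hom_act sec_gK !sec_VK subrr.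
Qed.

Lemma T_sec u : llT E (sec_V s u) = sec_g s (llT A u) + ig (calT s u).
Proof.
rewrite [ig _](pull_exactK (ext_exact_g E)) ?subrKC// linearB /=.
by rewrite -hom_T sec_gK sec_VK subrr.
Qed.

(** The lift of a bracket and the bracket of the lifts differ by an element of [h], which is
    invisible inside a further bracket by centrality. The next three lemmas are its analogues for
    the other slot and for the action. *)
Lemma br_secr x y z :
  lie_br (llg E) x (sec_g s (lie_br (llg A) y z)) =
    lie_br (llg E) x (lie_br (llg E) (sec_g s y) (sec_g s z)).
Proof. by rewrite br_sec linearD /= central_brr addr0. Qed.

Lemma br_secl x y z :
  lie_br (llg E) (sec_g s (lie_br (llg A) x y)) z =
    lie_br (llg E) (lie_br (llg E) (sec_g s x) (sec_g s y)) z.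
Proof. by rewrite br_sec linearDl central_brl addr0. Qed.

Lemma act_secr x y u :
  rep_act (llV E) x (sec_V s (rep_act (llV A) y u)) =
    rep_act (llV E) x (rep_act (llV E) (sec_g s y) (sec_V s u)).
Proof. by rewrite act_sec linearD /= central_actr addr0. Qed.

Lemma act_secl x y u :
  rep_act (llV E) (sec_g s (lie_br (llg A) x y)) u =
    rep_act (llV E) (lie_br (llg E) (sec_g s x) (sec_g s y)) u.
Proof. by rewrite br_sec linearDl central_actl addr0. Qed.

(** Every identity is tested after the injective inclusion of [h] or [W]. The closedness conditions
    then become the axioms of the extension at lifted elements minus the lifts of the axioms of
    [A]. *)
Lemma section_cocycle2 : is_cocycle2 TT (omega s) (varpi s) (calT s).
Proof.
have iomE x y : ig (omega s x y) =
  lie_br (llg E) (sec_g s x) (sec_g s y) - sec_g s (lie_br (llg A) x y).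
  by rewrite br_sec addrC addKr.
have ivpE x u : iV (varpi s x u) =
  rep_act (llV E) (sec_g s x) (sec_V s u) - sec_V s (rep_act (llV A) x u).
  by rewrite act_sec addrC addKr.
have ithE u : ig (calT s u) = llT E (sec_V s u) - sec_g s (llT A u).
  by rewrite T_sec addrC addKr.
split.
- split=> [y|x] a u v; apply: incl_g_inj; rewrite /= linP !iomE.
    by rewrite !(linP, bilPl) addrACA -scalerDr.
  by rewrite !linP addrACA -scalerDr.
- by move=> x; apply: incl_g_inj; rewrite iomE !lie_alt !linear0 addr0.
- split=> [y|x] a u v; apply: incl_V_inj; rewrite /= linP !ivpE.
    by rewrite !(linP, bilPl) addrACA -scalerDr.
  by rewrite !linP addrACA -scalerDr.
- move=> a u v; apply: incl_g_inj; rewrite linP !ithE.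
  by rewrite !linP addrACA -scalerDr.
- move=> x y z; apply: incl_g_inj; rewrite linearD /= !iomE.
  rewrite !br_secr br_secl [in LHS]lie_leibniz [lie_br _ x _]lie_leibniz.
  by rewrite linearD /= opprD addrACA.
- move=> x y v; apply: incl_V_inj; rewrite linearB /= !ivpE.
  rewrite !act_secr act_secl rep_br [rep_act _ (lie_br _ x y) v]rep_br linearB /=.
  by rewrite !opprD !opprK addrACA.
- move=> u v; apply: incl_g_inj; rewrite linearB /= iomE ithE -hom_T ivpE linearB /=.
  (* [s (T u)] and [llT E (s u)] differ by a central element, so [llTP] for
     [E] applies. *)
  have -> : lie_br (llg E) (sec_g s (llT A u)) (sec_g s (llT A v)) =
      llT E (rep_act (llV E) (sec_g s (llT A u)) (sec_V s v)).
    have sTE w : sec_g s (llT A w) = llT E (sec_V s w) - ig (calT s w).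
      by rewrite T_sec addrK.
    rewrite !sTE linearB /= central_brr subr0 !linearBl /=.
    by rewrite central_brl central_actl !subr0 llTP.
  by rewrite llTP opprB addrC addrA subrK.
Qed.

(** By centrality the kernel coordinates enter neither bracket nor action, and [T_decomp] sees them
    only through [TT]: the extension is recovered from [A], [TT] and the cocycle. *)
Lemma br_decomp x a y b :
  lie_br (llg E) (sec_g s x + ig a) (sec_g s y + ig b) =
    sec_g s (lie_br (llg A) x y) + ig (omega s x y).
Proof. by rewrite linearDl linearD /= central_brl central_brr !addr0 br_sec. Qed.

Lemma act_decomp x a u xi :
  rep_act (llV E) (sec_g s x + ig a) (sec_V s u + iV xi) =
    sec_V s (rep_act (llV A) x u) + iV (varpi s x u).
Proof. by rewrite linearDl linearD /= central_actl central_actr !addr0 act_sec. Qed.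

Lemma T_decomp u xi :
  llT E (sec_V s u + iV xi) = sec_g s (llT A u) + ig (calT s u + TT xi).
Proof. by rewrite linearD /= T_sec hom_T linearD /= addrA. Qed.

Lemma g_decomp x : exists z a, x = sec_g s z + ig a.
Proof. exact: (split_exactP (ext_exact_g E) (@sec_gK _ _ _ _ _ _ s)). Qed.

Lemma V_decomp u : exists v xi, u = sec_V s v + iV xi.
Proof. exact: (split_exactP (ext_exact_V E) (@sec_VK _ _ _ _ _ _ s)). Qed.

End OneSection.

(** * Change of section *)

Section Shift.
Variables (E : centralExt A TT) (s : ext_section E).
Variables (a : {linear llg A -> h}) (b : {linear llV A -> W}).

Definition shift_g (x : llg A) : llg E := sec_g s x + hom_g (ext_i E) (a x).
Definition shift_V (u : llV A) : llV E := sec_V s u + hom_V (ext_i E) (b u).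

Fact shift_g_linear : linear shift_g.
Proof. by move=> k x y; rewrite /shift_g !linP scalerDr addrACA. Qed.

Fact shift_V_linear : linear shift_V.
Proof. by move=> k x y; rewrite /shift_V !linP scalerDr addrACA. Qed.

Fact shift_gK x : hom_g (ext_p E) (pack_linear shift_g_linear x) = x.
Proof. by rewrite linearD /= sec_gK (exact_comp0 (ext_exact_g E)) addr0. Qed.

Fact shift_VK u : hom_V (ext_p E) (pack_linear shift_V_linear u) = u.
Proof. by rewrite linearD /= sec_VK (exact_comp0 (ext_exact_V E)) addr0. Qed.

Definition shift_section : ext_section E := ExtSection shift_gK shift_VK.

(** The shifts of the two arguments are central and vanish in the bracket; the only correction comes
    from the shifted lift of the bracket of [x] and [y]. *)
Lemma omega_shift x y :
  omega shift_section x y = omega s x y - a (lie_br (llg A) x y).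
Proof.
apply: (@incl_g_inj E); apply: (addrI (sec_g shift_section (lie_br _ x y))).
rewrite -br_sec br_decomp linearB /= /shift_g.
by rewrite addrA addrAC addrK.
Qed.

Lemma varpi_shift x u :
  varpi shift_section x u = varpi s x u - b (rep_act (llV A) x u).
Proof.
apply: (@incl_V_inj E); apply: (addrI (sec_V shift_section (rep_act _ x u))).
rewrite -act_sec act_decomp linearB /= /shift_V.
by rewrite addrA addrAC addrK.
Qed.

(** The shift acts twice here: [TT (b u)] comes from applying [llT E] to the shifted lift of [u],
    and [- a (llT A u)] from the shifted lift of [llT A u]. *)
Lemma calT_shift u :
  calT shift_section u = calT s u + (TT (b u) - a (llT A u)).
Proof.
apply: (@incl_g_inj E); apply: (addrI (sec_g shift_section (llT A u))).
rewrite -T_sec T_decomp addrA linearB /= /shift_g.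
by rewrite addrA addrAC addrK.
Qed.

End Shift.

(** Two sections differ by maps into the kernels, which exactness factors through the inclusions.
    The agreement is pointwise, as [section_cochain_ext] requires. *)
Lemma section_shift (E : centralExt A TT) (s t : ext_section E) :
  exists (a : {linear llg A -> h}) (b : {linear llV A -> W}),
    (forall x, sec_g t x = sec_g (shift_section s a b) x) /\
    (forall u, sec_V t u = sec_V (shift_section s a b) u).
Proof.
have pg0 x : hom_g (ext_p E) (sec_g t x - sec_g s x) = 0.
  by rewrite linearB /= !sec_gK subrr.
have pV0 u : hom_V (ext_p E) (sec_V t u - sec_V s u) = 0.
  by rewrite linearB /= !sec_VK subrr.
pose a x := pull_g (sec_g t x - sec_g s x).
pose b u := pull_V (sec_V t u - sec_V s u).
have aE x : hom_g (ext_i E) (a x) = sec_g t x - sec_g s x.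
  exact: (pull_exactK (ext_exact_g E)).
have bE u : hom_V (ext_i E) (b u) = sec_V t u - sec_V s u.
  exact: (pull_exactK (ext_exact_V E)).
have a_lin : linear a.
  move=> k x y; apply: (@incl_g_inj E); rewrite linP !aE !linP.
  by rewrite addrACA -scalerDr.
have b_lin : linear b.
  move=> k x y; apply: (@incl_V_inj E); rewrite linP !bE !linP.
  by rewrite addrACA -scalerDr.
exists (pack_linear a_lin), (pack_linear b_lin).
by split=> x /=; rewrite /shift_g /shift_V /= (aE, bE) subrKC.
Qed.

Lemma section_cochain_ext (E : centralExt A TT) (s t : ext_section E) :
  sec_g s =1 sec_g t -> sec_V s =1 sec_V t ->
  section_cochain s = section_cochain t.
Proof.
move=> eg eV; congr (_, _, _); apply/funext => x; last first.
- by rewrite /calT eg eV.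
- by apply/funext => u; rewrite /varpi eg !eV.
- by rewrite /omega !eg.
Qed.

(** * Extensions with equal cocycles *)

Section Transfer.
Variables (E F : centralExt A TT) (s : ext_section E) (t : ext_section F).
Hypothesis st : section_cochain s = section_cochain t.

Let omegaE x y : omega s x y = omega t x y.
Proof. exact: (congr1 (fun c : cochainFun A h W 2 => c.1.1 (pair2 x y)) st). Qed.

Let varpiE x u : varpi s x u = varpi t x u.
Proof. exact: (congr1 (fun c : cochainFun A h W 2 => c.1.2 (fun=> x) u) st). Qed.

Let calTE u : calT s u = calT t u.
Proof. exact: (congr1 (fun c : cochainFun A h W 2 => c.2 (fun=> u)) st). Qed.

Let eg := ext_exact_g E.
Let eV := ext_exact_V E.
Let sgK : cancel (sec_g s) (hom_g (ext_p E)) := @sec_gK _ _ _ _ _ _ s.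
Let sVK : cancel (sec_V s) (hom_V (ext_p E)) := @sec_VK _ _ _ _ _ _ s.

Definition transfer_g : {linear llg E -> llg F} :=
  pack_linear (transfer_linear (hom_g (ext_i F)) (sec_g t) eg sgK).
Definition transfer_V : {linear llV E -> llV F} :=
  pack_linear (transfer_linear (hom_V (ext_i F)) (sec_V t) eV sVK).

Let transfer_gE z a : transfer_g (sec_g s z + hom_g (ext_i E) a) =
  sec_g t z + hom_g (ext_i F) a.
Proof. exact: transferE. Qed.

Let transfer_VE z a : transfer_V (sec_V s z + hom_V (ext_i E) a) =
  sec_V t z + hom_V (ext_i F) a.
Proof. exact: transferE. Qed.

Fact transfer_br x y :
  transfer_g (lie_br _ x y) = lie_br _ (transfer_g x) (transfer_g y).
Proof.
have [[x' [a ->]] [y' [b ->]]] := (g_decomp s x, g_decomp s y).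
by rewrite br_decomp !transfer_gE br_decomp omegaE.
Qed.

Fact transfer_T u : llT F (transfer_V u) = transfer_g (llT E u).
Proof.
have [v [xi ->]] := V_decomp s u.
by rewrite transfer_VE !T_decomp transfer_gE calTE.
Qed.

Fact transfer_act x u :
  transfer_V (rep_act (llV E) x u) = rep_act (llV F) (transfer_g x) (transfer_V u).
Proof.
have [[x' [a ->]] [v [xi ->]]] := (g_decomp s x, V_decomp s u).
by rewrite act_decomp transfer_gE !transfer_VE act_decomp varpiE.
Qed.

(** In split coordinates both extensions obey the formulas of [br_decomp], [act_decomp] and
    [T_decomp] with the same cocycle, so carrying coordinates over is a homomorphism; the inverse
    carries them back. *)
Lemma eq_section_cochain_iso : ext_iso E F.
Proof.
have tgK : cancel (sec_g t) (hom_g (ext_p F)) := @sec_gK _ _ _ _ _ _ t.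
have tVK : cancel (sec_V t) (hom_V (ext_p F)) := @sec_VK _ _ _ _ _ _ t.
exists (LLHom transfer_br transfer_T transfer_act); split => /=.
- split.
    exact: (Bijective (transferK eg sgK (ext_exact_g F) tgK)
                      (transferK (ext_exact_g F) tgK eg sgK)).
  exact: (Bijective (transferK eV sVK (ext_exact_V F) tVK)
                    (transferK (ext_exact_V F) tVK eV sVK)).
- exact: (transfer_incl _ _ eg sgK).
- exact: (transfer_incl _ _ eV sVK).
- exact: (transfer_proj eg sgK (ext_exact_g F) tgK).
- exact: (transfer_proj eV sVK (ext_exact_V F) tVK).
Qed.

End Transfer.

(** The section is composed with the isomorphism; the latter is the identity on [h] and [W], so the
    defects of the section are unchanged. *)
Lemma iso_section (E F : centralExt A TT) (s : ext_section E) : ext_iso E F ->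
  exists t : ext_section F, section_cochain t = section_cochain s.
Proof.
move=> [f [_ fig fiV fpg fpV]].
have tgK x : hom_g (ext_p F) ((hom_g f \o sec_g s) x) = x.
  by rewrite /= fpg sec_gK.
have tVK u : hom_V (ext_p F) ((hom_V f \o sec_V s) u) = u.
  by rewrite /= fpV sec_VK.
exists (ExtSection tgK tVK); set t := ExtSection _ _.
congr (_, _, _); apply/funext => x.
- apply: (@incl_g_inj F); apply: (addrI (sec_g t (lie_br _ (x ord0) (x ord_max)))).
  by rewrite -br_sec -hom_br br_sec linearD /= fig.
- apply/funext => u; apply: (@incl_V_inj F).
  apply: (addrI (sec_V t (rep_act _ (x ord0) u))).
  by rewrite -act_sec -hom_act act_sec linearD /= fiV.
- apply: (@incl_g_inj F); apply: (addrI (sec_g t (llT A (x ord0)))).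
  by rewrite -T_sec hom_T T_sec linearD /= fig.
Qed.

(** * Isomorphism of extensions against cohomology of their cocycles *)

Lemma ext_section_exists (E : centralExt A TT) : inhabited (ext_section E).
Proof.
have [_ _ /linear_section [sg sgK]] := ext_exact_g E.
have [_ _ /linear_section [sV sVK]] := ext_exact_V E.
exact: inhabits (ExtSection sgK sVK).
Qed.

(** The coboundary formulas of [is_coboundary2P] are exactly the correction terms of [omega_shift],
    [varpi_shift] and [calT_shift]. *)
Lemma cohomologous_sectionsP (E F : centralExt A TT) (s : ext_section E)
    (t : ext_section F) :
  is_coboundary TT (section_cochain s - section_cochain t : cochainFun A h W 2)
  <-> exists a b, section_cochain s = section_cochain (shift_section t a b).
Proof.
have -> : (section_cochain s - section_cochain t : cochainFun A h W 2) =
  cochain2 (fun x y => omega s x y - omega t x y)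
    (fun x u => varpi s x u - varpi t x u) (fun u => calT s u - calT t u) by [].
rewrite is_coboundary2P; split=> [] [a [b]].
  move=> [oE vE tE]; exists a, b; congr (_, _, _); apply/funext => x.
  - by apply/eqP; rewrite omega_shift addrC -subr_eq oE.
  - by apply/funext => u; apply/eqP; rewrite varpi_shift addrC -subr_eq vE.
  - by apply/eqP; rewrite calT_shift addrC -subr_eq tE.
move=> e; exists a, b.
have oE x y : omega s x y = omega (shift_section t a b) x y.
  exact: (congr1 (fun c : cochainFun A h W 2 => c.1.1 (pair2 x y)) e).
have vE x u : varpi s x u = varpi (shift_section t a b) x u.
  exact: (congr1 (fun c : cochainFun A h W 2 => c.1.2 (fun=> x) u) e).
have tE u : calT s u = calT (shift_section t a b) u.
  exact: (congr1 (fun c : cochainFun A h W 2 => c.2 (fun=> u)) e).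
split=> [x y|x u|u].
- by rewrite oE omega_shift addrC addKr.
- by rewrite vE varpi_shift addrC addKr.
- by rewrite tE calT_shift addrC addKr.
Qed.

(** An isomorphism carries [s] to a section of [F] with the same cochain, and that section is a
    shift of [t]. Conversely, a shift of [t] with the cochain of [s] allows the transfer of
    coordinates. *)
Lemma ext_iso_cohomologous (E F : centralExt A TT) (s : ext_section E)
    (t : ext_section F) :
  ext_iso E F <->
  is_coboundary TT (section_cochain s - section_cochain t : cochainFun A h W 2).
Proof.
rewrite cohomologous_sectionsP; split=> [/(iso_section s) [s' <-]|[a [b e]]].
  have [a [b [eg eV]]] := section_shift t s'; exists a, b.
  exact: section_cochain_ext.
exact: eq_section_cochain_iso e.
Qed.

Lemma section_cochain_is_cocycle (E : centralExt A TT) (s : ext_section E) :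
  (section_cochain s : cochainFun A h W 2) \in @is_cocycle K A h W TT 2.
Proof.
have [? ? ? ? ? ? ?] := section_cocycle2 s.
apply/asboolP; split; first exact/is_cochain2P.
exact/D_cochain2P.
Qed.

Definition section_cocycle (E : centralExt A TT) (s : ext_section E) :
  cocycle A TT 2 := Cocycle (section_cochain_is_cocycle s).

Lemma coh_class_eqP n (c d : cocycle A TT n) :
  coh_class c = coh_class d <->
  is_coboundary TT (cocycle_val c - cocycle_val d).
Proof.
split=> [/eqP|cd]; last apply/eqP; rewrite -Quotient.idealrBE.
  by move=> /asboolP; rewrite raddfB.
by apply/asboolP; rewrite raddfB.
Qed.

Lemma ext_isoP (E F : centralExt A TT) (s : ext_section E) (t : ext_section F) :
  ext_iso E F <->
  coh_class (section_cocycle s) = coh_class (section_cocycle t).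
Proof. by rewrite coh_class_eqP; exact: ext_iso_cohomologous. Qed.

(** * The extension defined by a cocycle *)

Section Twisted.
Variables (om : llg A -> llg A -> h) (vp : llg A -> llV A -> W) (th : llV A -> h).
Hypothesis cocyc : is_cocycle2 TT om vp th.

Definition tw_g : lmodType K := (llg A * h)%type.
Definition tw_V : lmodType K := (llV A * W)%type.

(** The formulas of [br_decomp], [act_decomp] and [T_decomp], now taken as definitions on the
    products. *)
Definition tw_br (x y : tw_g) : tw_g := (lie_br (llg A) x.1 y.1, om x.1 y.1).
Definition tw_act (x : tw_g) (u : tw_V) : tw_V :=
  (rep_act (llV A) x.1 u.1, vp x.1 u.1).
Definition tw_T (u : tw_V) : tw_g := (llT A u.1, th u.1 + TT u.2).

Fact tw_br_bilinear : bilinear_for *:%R *:%R tw_br.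
Proof.
have [om_l om_r] := om_bilinear cocyc.
split=> [y|x] k u v; apply: injective_projections => /=.
- exact: bilPl.
- exact: om_l.
- exact: bilPr.
- exact: om_r.
Qed.

Fact tw_act_bilinear : bilinear_for *:%R *:%R tw_act.
Proof.
have [vp_l vp_r] := vp_bilinear cocyc.
split=> [y|x] k u v; apply: injective_projections => /=.
- exact: bilPl.
- exact: vp_l.
- exact: bilPr.
- exact: vp_r.
Qed.

Fact tw_T_linear : linear tw_T.
Proof.
move=> k u v; apply: injective_projections => /=; first exact: linP.
by rewrite (th_linear cocyc) linP scalerDr addrACA.
Qed.

Fact tw_alt x : pack_bilinear tw_br_bilinear x x = 0.
Proof.
by apply: injective_projections; rewrite /= ?lie_alt ?(om_alt cocyc).
Qed.

Fact tw_jacobi x y z (b := pack_bilinear tw_br_bilinear) :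
  b x (b y z) + b y (b z x) + b z (b x y) = 0.
Proof.
have anti := alternating2_anti (om_bilinear cocyc) (om_alt cocyc).
apply: injective_projections => /=; first exact: lie_jacobi.
have omN u v : om u (- v) = - om u v.
  exact: (linearN (pack_bilinear (om_bilinear cocyc) u)).
(* Closedness expands the first term of the cyclic sum; antisymmetry of [om] and of the bracket
   makes the other two cancel the result. *)
rewrite (om_jacobi cocyc) [om z.1 _]anti [lie_br _ z.1 x.1]lie_anti omN.
by rewrite addrK subrr.
Qed.

Definition tw_lie : lieAlgebra K := LieAlgebra tw_alt tw_jacobi.

Fact tw_rep (x y : tw_lie) (u : tw_V) (r := pack_bilinear tw_act_bilinear) :
  r (lie_br tw_lie x y) u = r x (r y u) - r y (r x u).
Proof.
apply: injective_projections => /=; first exact: rep_br.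
exact: (vp_rep cocyc).
Qed.

Definition tw_lieRep : lieRep tw_lie := @LieRep K tw_lie tw_V _ tw_rep.

Fact tw_TP (u v : tw_lieRep) (t := pack_linear tw_T_linear) :
  lie_br tw_lie (t u) (t v) = t (rep_act tw_lieRep (t u) v).
Proof.
apply: injective_projections => /=; first exact: llTP.
by rewrite -(th_T cocyc) subrK.
Qed.

Definition tw_triple : lieLeibniz K := @LieLeibniz K tw_lie tw_lieRep _ tw_TP.

Let om0r x : om x 0 = 0.
Proof. exact: (linear0 (pack_bilinear (om_bilinear cocyc) x)). Qed.
Let om0l x : om 0 x = 0.
Proof. exact: (linear0l (pack_bilinear (om_bilinear cocyc)) x). Qed.
Let vp0r x : vp x 0 = 0.
Proof. exact: (linear0 (pack_bilinear (vp_bilinear cocyc) x)). Qed.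
Let vp0l x : vp 0 x = 0.
Proof. exact: (linear0l (pack_bilinear (vp_bilinear cocyc)) x). Qed.
Let th0 : th 0 = 0.
Proof. exact: (linear0 (pack_linear (th_linear cocyc))). Qed.

Let ig : {linear llg (trivialTriple TT) -> llg tw_triple} :=
  pack_linear (@inr_linear K (llg A) h).
Let iV : {linear llV (trivialTriple TT) -> llV tw_triple} :=
  pack_linear (@inr_linear K (llV A) W).
Let pg : {linear llg tw_triple -> llg A} := @fst (llg A) h.
Let pV : {linear llV tw_triple -> llV A} := @fst (llV A) W.

Fact tw_i_br x y : ig (lie_br _ x y) = lie_br _ (ig x) (ig y).
Proof. by apply: injective_projections; rewrite /= ?linear0 ?om0r. Qed.
Fact tw_i_T u : llT tw_triple (iV u) = ig (llT (trivialTriple TT) u).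
Proof. by apply: injective_projections; rewrite /= ?linear0 ?th0 ?add0r. Qed.
Fact tw_i_act x u : iV (rep_act _ x u) = rep_act _ (ig x) (iV u).
Proof. by apply: injective_projections; rewrite /= ?linear0 ?vp0r. Qed.

Definition tw_incl := LLHom tw_i_br tw_i_T tw_i_act.

Fact tw_p_br x y : pg (lie_br _ x y) = lie_br _ (pg x) (pg y).
Proof. by []. Qed.
Fact tw_p_T u : llT A (pV u) = pg (llT tw_triple u).
Proof. by []. Qed.
Fact tw_p_act x u : pV (rep_act _ x u) = rep_act _ (pg x) (pV u).
Proof. by []. Qed.

Definition tw_proj := LLHom tw_p_br tw_p_T tw_p_act.

Definition tw_ext : extension A TT :=
  @Extension K A h W TT tw_triple tw_incl tw_proj
    (prod_short_exact _ _) (prod_short_exact _ _).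

Fact tw_central : is_central tw_ext.
Proof.
split=> [a x|x xi|a u]; apply: injective_projections => /=.
- exact: linear0l.
- exact: om0l.
- exact: linear0.
- exact: vp0r.
- exact: linear0l.
- exact: vp0l.
Qed.

Definition twisted : centralExt A TT := CentralExt tw_central.

Let sg : {linear llg A -> llg twisted} := pack_linear (@inl_linear K (llg A) h).
Let sV : {linear llV A -> llV twisted} := pack_linear (@inl_linear K (llV A) W).

Definition tw_section : ext_section twisted :=
  @ExtSection K A h W TT twisted sg sV (fun=> erefl) (fun=> erefl).

(** On lifts of the form [(x, 0)] the second coordinates of [tw_br], [tw_act] and [tw_T] are [om],
    [vp] and [th]. *)
Lemma tw_section_cochain : section_cochain tw_section = cochain2 om vp th.
Proof.
congr (_, _, _); apply/funext => x.
- apply: (@incl_g_inj twisted).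
  apply: (addrI (sec_g tw_section (lie_br _ (x ord0) (x ord_max)))).
  rewrite -br_sec.
  by apply: injective_projections; rewrite /= ?addr0 ?add0r.
- apply/funext => u; apply: (@incl_V_inj twisted).
  apply: (addrI (sec_V tw_section (rep_act _ (x ord0) u))).
  rewrite -act_sec.
  by apply: injective_projections; rewrite /= ?addr0 ?add0r.
- apply: (@incl_g_inj twisted).
  apply: (addrI (sec_g tw_section (llT A (x ord0)))).
  rewrite -T_sec.
  by apply: injective_projections; rewrite /= ?linear0 ?addr0 ?add0r.
Qed.

End Twisted.

(** Surjectivity already at the level of cocycles: the twisted product realizes [c] itself and not
    merely its class. *)
Lemma cocycle_section (c : cocycle A TT 2) :
  exists (E : centralExt A TT) (s : ext_section E), section_cocycle s = c.
Proof.
have /asboolP [] := cocycleP c.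
rewrite (cochain2_eta c) => /is_cochain2P [? ? ? ?] /D_cochain2P [? ? ?].
have H : is_cocycle2 TT (fun x y => (cocycle_val c).1.1 (pair2 x y))
  (fun x => (cocycle_val c).1.2 (fun=> x)) (fun u => (cocycle_val c).2 (fun=> u)).
  by split.
exists (twisted H), (tw_section H); apply: val_inj.
by rewrite /= tw_section_cochain -cochain2_eta.
Qed.

End CentralExtensions.

(** * The bijection on isomorphism classes *)

Theorem theorem5p19 (K : fieldType) (A : lieLeibniz K) (h W : lmodType K)
    (TT : {linear W -> h}) :
  (forall E : centralExt A TT, inhabited (ext_section E)) /\
  exists Phi : iso_classes A TT -> cohomology A TT 2,
    bijective Phi /\
    forall (E : centralExt A TT) (s : ext_section E),
      exists2 c : cocycle A TT 2,
        cocycle_val c = section_cochain s & Phi (iso_class E) = coh_class c.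
Proof.
split; first exact: ext_section_exists.
pose sec (E : centralExt A TT) := inhabited_witness (ext_section_exists E).
pose cls (E : centralExt A TT) := coh_class (section_cocycle (sec E)).
have clsE (E : centralExt A TT) (s : ext_section E) :
    cls E = coh_class (section_cocycle s).
  (* Independence of the section is [ext_isoP] for [E] against itself; reflexivity of [ext_iso]
     comes from the same equivalence with one section used twice. *)
  by apply/ext_isoP/(ext_isoP s s).
have isoE (E F : centralExt A TT) : ext_iso E F <-> cls E = cls F by exact: ext_isoP.
pose rep (C : iso_classes A TT) := projT1 (cid (svalP C)).
have repE C : sval C = ext_iso (rep C) by exact: projT2 (cid (svalP C)).
have rep_iso E : cls (rep (iso_class E)) = cls E.
  (* [E] lies in its own class, hence is isomorphic to the chosen representative. *)
  by apply/isoE; rewrite -repE; apply/isoE.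
have rep_inj : injective (cls \o rep).
  move=> C C' /= e; have eC : sval C = sval C'.
    (* Membership of [F] in a class depends only on the value of [cls] at the representative, so
       equal values give equal predicates. *)
    by rewrite !repE; apply/funext => F; apply/propext; rewrite !isoE e.
  by case: C C' eC {e} => [? ?] [? ?] /= eC; apply: eq_exist.
have rep_surj q : exists C, (cls \o rep) C = q.
  have [E [s es]] := cocycle_section (repr q).
  by exists (iso_class E); rewrite /= rep_iso (clsE _ s) es /coh_class reprK.
exists (cls \o rep); split.
  have [inv invK] := choice rep_surj.
  (* A right inverse of an injective map is two-sided. *)
  by exists inv => // C; apply: rep_inj.
by move=> E s; exists (section_cocycle s) => //; rewrite /= rep_iso; exact: clsE.
Qed.
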